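(* Let $\hat{\Pi}_t=\hat{\sigma}_t(M_t)$, $t=0,\dots,T$, be approximate information states with parameters $\epsilon_t\in\mathbb{R}_{\ge0}$, and let $L_{\hat{V}_{t+1}}$ be the Lipschitz constant of $\hat{V}_{t+1}$ for all $t=0,\dots,T-1$. Then for all $t=0,\dots,T$, all $m_t\in\mathcal{M}_t$ and all $u_t\in\mathcal{U}$, $$|Q_t(m_t,u_t)-\hat{Q}_t(\hat{\sigma}_t(m_t),u_t)|\le\alpha_t,\qquad |V_t(m_t)-\hat{V}_t(\hat{\sigma}_t(m_t))|\le\alpha_t,$$ where $\alpha_T=(L_{c_T}+1)\cdot\epsilon_T$ and, for $t=0,\dots,T-1$, $\alpha_t=\alpha_{t+1}+(2L_t+1)\cdot\epsilon_t$ with $L_t=\max\{L_{\hat{V}_{t+1}},L_{c_t}\}$.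
   Context: **System.** Let $T\in\mathbb{N}$ and let $\mathcal{X},\mathcal{U},\mathcal{Y},\mathcal{W},\mathcal{N}$ be finite nonempty subsets of a metric space $(\mathcal{S},d)$. The data are functions $f_t:\mathcal{X}\times\mathcal{U}\times\mathcal{W}\to\mathcal{X}$ ($t=0,\dots,T-1$), $h_t:\mathcal{X}\times\mathcal{N}\to\mathcal{Y}$ and $c_t:\mathcal{X}\times\mathcal{U}\to\mathbb{R}_{\ge0}$ ($t=0,\dots,T$). The state evolves by $X_{t+1}=f_t(X_t,U_t,W_t)$ from $X_0\in\mathcal{X}$, the observation is $Y_t=h_t(X_t,N_t)$, and the memory is $M_t=(Y_{0:t},U_{0:t-1})$ (so $M_0=Y_0$). The accrued cost is $A_t=\sum_{\ell=0}^{t-1}c_\ell(X_\ell,U_\ell)$, $A_0=0$, taking values in a finite set $\mathcal{A}_t\subset\mathbb{R}_{\ge0}$. The uncontrolled inputs $X_0$, $W_t$ ($t\le T-1$), $N_t$ ($t\le T$) are mutually independent in the non-stochastic sense: their joint range is the full product of $\mathcal{X}$, copies of $\mathcal{W}$ and copies of $\mathcal{N}$. **Ranges.** An uncertain variable is a map on a sample space $\Omega$. For uncertain variables $\mathsf{X},\mathsf{Y}$, $[[\mathsf{X}]]=\{\mathsf{X}(\omega):\omega\in\Omega\}$ and $[[\mathsf{X}|\mathsf{y}]]=\{\mathsf{X}(\omega):\omega\in\Omega,\ \mathsf{Y}(\omega)=\mathsf{y}\}$; tuples are treated as single uncertain variables. Conditional ranges of system variables (given realizations such as $m_t$, $(m_t,u_t)$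 or $(\hat{\pi}_t,u_t)$) do not depend on a strategy: they are taken on $\Omega=\mathcal{X}\times\mathcal{W}^{T}\times\mathcal{N}^{T+1}\times\mathcal{U}^{T+1}$, the set of all realizations of the uncontrolled inputs and of action sequences $u_{0:T}$. $\mathcal{M}_t=[[M_t]]$ is the set of realizable memories. **Indicator and accrued distribution.** $\mathbb{I}(\mathsf{x}|\mathsf{y})=0$ if $\mathsf{x}\in[[\mathsf{X}|\mathsf{y}]]$ and $-\infty$ otherwise. For $\mathsf{y}\in[[\mathsf{Y}]]$, $$r_t(\mathsf{x}|\mathsf{y})=\max_{a_t\in\mathcal{A}_t}\big(a_t+\mathbb{I}(\mathsf{x},a_t|\mathsf{y})\big)-\max_{a_t\in\mathcal{A}_t}\big(a_t+\mathbb{I}(a_t|\mathsf{y})\big)\in\{-\infty\}\cup(-\infty,0],$$ with a real number plus $-\infty$ equal to $-\infty$. It is finite exactly when $\mathsf{x}\in[[\mathsf{X}|\mathsf{y}]]$. The function $\mathsf{x}\mapsto r_t(\mathsf{x}|\mathsf{y})$ is written $r_t(\mathsf{X}|\mathsf{y})$. **Distance.** For nonempty finite sets $\mathscr{A},\mathscr{B}$ in a metric space, $\mathcal{H}(\mathscr{A},\mathscr{B})=\max\{\max_{x\in\mathscr{A}}\min_{y\in\mathscr{B}}d(x,y),\max_{y\in\mathscr{B}}\min_{x\in\mathscr{A}}d(x,y)\}$. For an uncertain variable $\mathsf{X}$ with values in a finite subset of a metric space and realizations $\mathsf{y},\mathsf{z}$ of uncertain variables, $$\mathcal{R}\big(r_t(\mathsf{X}|\mathsf{y}),r_t(\mathsf{X}|\mathsf{z})\big)=\max\Big(\mathcal{H}\big([[\mathsf{X}|\mathsf{y}]],[[\mathsf{X}|\mathsf{z}]]\big),\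 \max_{\mathsf{x}\in[[\mathsf{X}|\mathsf{y}]]\cup[[\mathsf{X}|\mathsf{z}]]}\big|r_t(\psi^{\mathsf{y}}(\mathsf{x})|\mathsf{y})-r_t(\psi^{\mathsf{z}}(\mathsf{x})|\mathsf{z})\big|\Big),$$ where $\psi^{\mathsf{y}}(\mathsf{x})\in\arg\min_{\hat{\mathsf{x}}\in[[\mathsf{X}|\mathsf{y}]]}d(\hat{\mathsf{x}},\mathsf{x})$ and $\psi^{\mathsf{z}}(\mathsf{x})\in\arg\min_{\hat{\mathsf{x}}\in[[\mathsf{X}|\mathsf{z}]]}d(\hat{\mathsf{x}},\mathsf{x})$ (any fixed selections). Products of metric spaces carry the maximum metric. **Memory-based dynamic program.** $Q_T(m_T,u_T)=\max_{x_T\in\mathcal{X}}(c_T(x_T,u_T)+r_T(x_T|m_T))$; for $t<T$, $$Q_t(m_t,u_t)=\max_{x_t\in\mathcal{X},\,m_{t+1}\in\mathcal{M}_{t+1}}\big(c_t(x_t,u_t)+V_{t+1}(m_{t+1})+r_t(x_t,m_{t+1}|m_t,u_t)\big);$$ for all $t$, $V_t(m_t)=\min_{u_t\in\mathcal{U}}Q_t(m_t,u_t)$. **Approximate information state.** For each $t=0,\dots,T$, it is an uncertain variable $\hat{\Pi}_t=\hat{\sigma}_t(M_t)$ with values in a finite subset $\hat{\mathcal{P}}_t=[[\hat{\Pi}_t]]$ of some metric space, $\hat{\sigma}_t:\mathcal{M}_t\to\hat{\mathcal{P}}_t$, with a parameter $\epsilon_t\ge0$ such that for all $m_t\in\mathcal{M}_t$,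 $u_t\in\mathcal{U}$: $\mathcal{R}\big(r_t(X_t,\hat{\Pi}_{t+1}|m_t,u_t),\,r_t(X_t,\hat{\Pi}_{t+1}|\hat{\sigma}_t(m_t),u_t)\big)\le\epsilon_t$ for $t=0,\dots,T-1$, and $\mathcal{R}\big(r_T(X_T|m_T),\,r_T(X_T|\hat{\sigma}_T(m_T))\big)\le\epsilon_T$. **Approximate dynamic program.** $\hat{Q}_T(\hat{\pi}_T,u_T)=\max_{x_T\in\mathcal{X}}(c_T(x_T,u_T)+r_T(x_T|\hat{\pi}_T,u_T))$; for $t<T$, $$\hat{Q}_t(\hat{\pi}_t,u_t)=\max_{x_t\in\mathcal{X},\,\hat{\pi}_{t+1}\in\hat{\mathcal{P}}_{t+1}}\big(\hat{V}_{t+1}(\hat{\pi}_{t+1})+c_t(x_t,u_t)+r_t(x_t,\hat{\pi}_{t+1}|\hat{\pi}_t,u_t)\big);$$ for all $t$, $\hat{V}_t(\hat{\pi}_t)=\min_{u_t\in\mathcal{U}}\hat{Q}_t(\hat{\pi}_t,u_t)$. **Lipschitz constants.** $L_{c_t}$ is the Lipschitz constant of $c_t$ on $\mathcal{X}\times\mathcal{U}$ and $L_{\hat{V}_{t}}$ that of $\hat{V}_t$ on $\hat{\mathcal{P}}_t$ (finite because the sets are finite). *)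

(* Defs.v *)
From HB Require Import structures.
From mathcomp Require Import all_boot all_order all_algebra finmap.
From mathcomp Require Import all_classical all_reals all_analysis.

Set Implicit Arguments.
Unset Strict Implicit.
Unset Printing Implicit Defensive.

Import Order.TTheory GRing.Theory Num.Theory.

Local Open Scope fset_scope.
Local Open Scope ereal_scope.
Local Open Scope ring_scope.

(* The maximum metric on products; the library provides only the
   pseudometric structure of a product. *)
Section product_metric.
Context {R : realType} {S1 S2 : metricType R}.

Let dist (p q : S1 * S2) : R :=
  Num.max (mdist p.1 q.1) (mdist p.2 q.2).

Let dist_ge0 p q : 0 <= dist p q.
Proof. by rewrite /dist le_max mdist_ge0. Qed.

Let dist_positivity p q : dist p q = 0 -> p = q.
Proof.
case: p q => [p1 p2] [q1 q2] /eqP; rewrite eq_le ge_max => /andP[/andP[/= h1 h2] _].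
by congr pair; apply: mdist_positivity; apply/le_anti; rewrite mdist_ge0 andbT.
Qed.

Let ballEdist (p : S1 * S2) (d : R) : ball p d = [set q | dist p q < d]%classic.
Proof.
apply/seteqP; split=> q /=; rewrite /ball /= /prod_ball !ballEmdist /= /dist gt_max.
  by case=> -> ->.
by move=> /andP[].
Qed.

HB.instance Definition _ :=
  PseudoMetric_isMetric.Build R (S1 * S2)%type dist_ge0 dist_positivity ballEdist.

Lemma mdist_prodE (p q : S1 * S2) :
  mdist p q = Num.max (mdist p.1 q.1) (mdist p.2 q.2).
Proof. by []. Qed.

End product_metric.

Section metric_notions.
Context {R : realType}.

(* Used on nonempty finite sets only, so that the neutral elements of the
   maxima and minima play no role. *)
Definition hausdorff (E : metricType R) (A B : {fset E}) : \bar R :=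
  maxe (\big[maxe/-oo%E]_(x <- A) \big[mine/+oo%E]_(y <- B) (mdist x y)%:E)
       (\big[maxe/-oo%E]_(y <- B) \big[mine/+oo%E]_(x <- A) (mdist x y)%:E).

(* The largest difference quotient of [g] over a finite set listed by [D] with
   distance [d]; the quotient is 0 / 0 = 0 when x = y. *)
Definition lipschitz_const (I : Type) (D : seq I) (d : I -> I -> R)
    (g : I -> R) : R :=
  \big[Num.max/0]_(x <- D) \big[Num.max/0]_(y <- D) (`|g x - g y| / d x y).

End metric_notions.

(* Uncertain variables are maps on a finite sample space [Omega]. *)
Section uncertain_variables.
Context {R : realType} {Omega : finType}.

Definition urange (E : choiceType) (X : Omega -> E) : {fset E} :=
  [fset X w | w in Omega].

Definition crange (E : choiceType) (F : eqType) (X : Omega -> E)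
    (Y : Omega -> F) (y : F) : {fset E} :=
  [fset X w | w in Omega & Y w == y].

Definition indic (E : choiceType) (F : eqType) (X : Omega -> E) (x : E)
    (Y : Omega -> F) (y : F) : \bar R :=
  if x \in crange X Y y then 0%E else -oo%E.

(* [A] is the accrued cost and [Aset] a finite set containing its values. *)
Definition accrued_distr (A : Omega -> R) (Aset : {fset R})
    (E : choiceType) (F : eqType) (X : Omega -> E) (x : E)
    (Y : Omega -> F) (y : F) : \bar R :=
  (\big[maxe/-oo]_(a <- Aset) (a%:E + indic (fun w => (X w, A w)) (x, a) Y y)
   - \big[maxe/-oo]_(a <- Aset) (a%:E + indic A a Y y))%E.

(* [psi X Y y] is the nearest-point selection x |-> psi^y(x) on the conditional
   range of [X] given [Y = y]. *)
Definition selection_family : Type :=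
  forall (E : metricType R) (F : eqType),
    (Omega -> E) -> (Omega -> F) -> F -> E -> E.

Definition nearest_selections (psi : selection_family) : Prop :=
  forall (E : metricType R) (F : eqType) (X : Omega -> E) (Y : Omega -> F)
         (w : Omega) (x : E),
    psi E F X Y (Y w) x \in crange X Y (Y w) /\
    forall x', x' \in crange X Y (Y w) ->
      mdist (psi E F X Y (Y w) x) x <= mdist x' x.

Definition distr_dist (psi : selection_family) (A : Omega -> R)
    (Aset : {fset R}) (E : metricType R) (F G : eqType) (X : Omega -> E)
    (Y : Omega -> F) (y : F) (Z : Omega -> G) (z : G) : \bar R :=
  maxe (hausdorff (crange X Y y) (crange X Z z))
       (\big[maxe/-oo%E]_(x <- crange X Y y `|` crange X Z z)
          `| accrued_distr A Aset X (psi E F X Y y x) Y y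
             - accrued_distr A Aset X (psi E G X Z z x) Z z |%E).

End uncertain_variables.

Arguments selection_family R Omega : clear implicits.

(* Time-indexed data are indexed by all of [nat]; only the indices up to the
   horizon (strictly below it for the dynamics) are ever used. *)
Record system (R : realType) := System {
  space : metricType R;
  horizon : nat;
  Xset : {fset space};
  Uset : {fset space};
  Yset : {fset space};
  Wset : {fset space};
  Nset : {fset space};
  Xset_neq0 : Xset != fset0;
  Uset_neq0 : Uset != fset0;
  Yset_neq0 : Yset != fset0;
  Wset_neq0 : Wset != fset0;
  Nset_neq0 : Nset != fset0;
  dyn : nat -> Xset -> Uset -> Wset -> Xset;
  obs : nat -> Xset -> Nset -> Yset;
  cost : nat -> Xset -> Uset -> R;
  cost_ge0 : forall t x u, (t <= horizon)%N -> 0 <= cost t x u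
}.

Section system_variables.
Context {R : realType} (P : system R).
Local Notation T := (horizon P).

(* All realizations of (X_0, W_{0:T-1}, N_{0:T}, U_{0:T}). *)
Definition sample : finType :=
  (Xset P * {ffun 'I_T -> Wset P} * {ffun 'I_T.+1 -> Nset P}
   * {ffun 'I_T.+1 -> Uset P})%type.

Definition action (t : nat) (w : sample) : Uset P := w.2 (inord t).

Definition noise (t : nat) (w : sample) : Nset P := w.1.2 (inord t).

(* [insub s] is the index [s : 'I_T] when [s < T]; the state is meant for
   [t <= T] and is frozen afterwards. *)
Fixpoint state (t : nat) (w : sample) : Xset P :=
  if t is s.+1 then
    if insub s is Some i then
      dyn s (state s w) (action s w) (w.1.1.2 i)
    else state s w
  else w.1.1.1.

(* The state as a point of the ambient metric space. *)
Definition statev (t : nat) (w : sample) : space P := val (state t w).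

Definition observation (t : nat) (w : sample) : Yset P :=
  obs t (state t w) (noise t w).

(* Values of (Y_{0:t}, U_{0:t-1}). *)
Definition memory (t : nat) : finType :=
  (t.+1.-tuple (Yset P) * t.-tuple (Uset P))%type.

Definition mem_var (t : nat) (w : sample) : memory t :=
  ([tuple observation i w | i < t.+1], [tuple action i w | i < t]).

Definition memories (t : nat) : {fset memory t} := urange (mem_var t).

Definition mem_action (t : nat) (w : sample) : memory t * Uset P :=
  (mem_var t w, action t w).

Definition accrued (t : nat) (w : sample) : R :=
  \sum_(l < t) cost l (state l w) (action l w).

End system_variables.

(* A system together with finite sets containing the values of the accrued
   costs. *)
Record model (R : realType) := Model {
  model_system :> system R;
  Aset : nat -> {fset R};
  Aset_ge0 : forall t a, (t <= horizon model_system)%N ->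
    a \in Aset t -> 0 <= a;
  accrued_Aset : forall t (w : sample model_system), (t <= horizon model_system)%N ->
    accrued t w \in Aset t
}.

Section dynamic_programs.
Context {R : realType} (P : model R).
Local Notation T := (horizon P).

Definition rdistr (t : nat) (E : choiceType) (F : eqType)
    (X : sample P -> E) (x : E) (Y : sample P -> F) (y : F) : \bar R :=
  accrued_distr (accrued t) (Aset P t) X x Y y.

Definition Rdist (psi : selection_family R (sample P)) (t : nat)
    (E : metricType R) (F G : eqType) (X : sample P -> E)
    (Y : sample P -> F) (y : F) (Z : sample P -> G) (z : G) : \bar R :=
  distr_dist psi (accrued t) (Aset P t) X Y y Z z.

Definition Q_last (t : nat) (m : memory P t) (u : Uset P) : \bar R :=
  (\big[maxe/-oo]_(x : Xset P)
     ((cost t x u)%:E + rdistr t (statev t) (val x) (mem_var t) m))%E.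

Definition Q_step (t : nat) (Vnext : memory P t.+1 -> \bar R)
    (m : memory P t) (u : Uset P) : \bar R :=
  (\big[maxe/-oo]_(x : Xset P) \big[maxe/-oo]_(m' <- memories P t.+1)
     ((cost t x u)%:E + Vnext m'
      + rdistr t (fun w => (statev t w, mem_var t.+1 w)) (val x, m')
          (mem_action t) (m, u)))%E.

(* [k] is the number of remaining stages. *)
Fixpoint Q_rec (k t : nat) : memory P t -> Uset P -> \bar R :=
  if k is k'.+1 then
    @Q_step t (fun m' => \big[mine/+oo%E]_(u' : Uset P) @Q_rec k' t.+1 m' u')
  else @Q_last t.

Definition Q (t : nat) : memory P t -> Uset P -> \bar R := @Q_rec (T - t) t.

Definition V (t : nat) (m : memory P t) : \bar R :=
  \big[mine/+oo%E]_(u : Uset P) Q m u.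

Lemma Q_lastE (m : memory P T) (u : Uset P) : Q m u = Q_last m u.
Proof. by rewrite /Q subnn. Qed.

Lemma Q_stepE (t : nat) (m : memory P t) (u : Uset P) :
  (t < T)%N -> Q m u = Q_step (@V t.+1) m u.
Proof. by move=> tT; rewrite /Q -(subnSK tT). Qed.

Section approximate.
(* [sigma t] is only ever evaluated on realizable memories. *)
Variables (S : nat -> metricType R) (sigma : forall t, memory P t -> S t).

Definition info_var (t : nat) (w : sample P) : S t := sigma (mem_var t w).

Definition info_set (t : nat) : {fset S t} := urange (@info_var t).

Definition info_action (t : nat) (w : sample P) : S t * Uset P :=
  (info_var t w, action t w).

Definition state_info (t : nat) (w : sample P) : space P * S t.+1 :=
  (statev t w, info_var t.+1 w).

Record approx_info_state (psi : selection_family R (sample P))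
    (eps : nat -> R) : Prop := ApproxInfoState {
  ais_eps_ge0 : forall t, (t <= T)%N -> 0 <= eps t;
  ais_step : forall t, (t < T)%N ->
    forall (m : memory P t) (u : Uset P), m \in memories P t ->
    (Rdist psi t (@state_info t)
       (@mem_action _ P t) (m, u) (@info_action t) (sigma m, u)
     <= (eps t)%:E)%E;
  ais_last : forall m : memory P T, m \in memories P T ->
    (Rdist psi T (@statev _ P T) (mem_var T) m (@info_var T) (sigma m)
     <= (eps T)%:E)%E
}.

Definition Qhat_last (t : nat) (p : S t) (u : Uset P) : \bar R :=
  (\big[maxe/-oo]_(x : Xset P)
     ((cost t x u)%:E + rdistr t (statev t) (val x) (@info_action t) (p, u)))%E.

Definition Qhat_step (t : nat) (Vnext : S t.+1 -> \bar R)
    (p : S t) (u : Uset P) : \bar R :=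
  (\big[maxe/-oo]_(x : Xset P) \big[maxe/-oo]_(p' <- info_set t.+1)
     (Vnext p' + (cost t x u)%:E
      + rdistr t (@state_info t) (val x, p') (@info_action t) (p, u)))%E.

Fixpoint Qhat_rec (k t : nat) : S t -> Uset P -> \bar R :=
  if k is k'.+1 then
    @Qhat_step t (fun p' => \big[mine/+oo%E]_(u' : Uset P) @Qhat_rec k' t.+1 p' u')
  else @Qhat_last t.

Definition Qhat (t : nat) : S t -> Uset P -> \bar R := @Qhat_rec (T - t) t.

Definition Vhat (t : nat) (p : S t) : \bar R :=
  \big[mine/+oo%E]_(u : Uset P) Qhat p u.

Lemma Qhat_lastE (p : S T) (u : Uset P) : Qhat p u = Qhat_last p u.
Proof. by rewrite /Qhat subnn. Qed.

Lemma Qhat_stepE (t : nat) (p : S t) (u : Uset P) :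
  (t < T)%N -> Qhat p u = Qhat_step (@Vhat t.+1) p u.
Proof. by move=> tT; rewrite /Qhat -(subnSK tT). Qed.

(* The values of [Vhat] on [info_set] are finite, so that [fine] loses
   nothing. *)
Definition lip_Vhat (t : nat) : R :=
  lipschitz_const (info_set t) (@mdist R (S t)) (fun p => fine (Vhat p)).

End approximate.

Definition lip_cost (t : nat) : R :=
  lipschitz_const (enum {: Xset P * Uset P})
    (fun p q => mdist (val p.1, val p.2) (val q.1, val q.2))
    (fun p => cost t p.1 p.2).

End dynamic_programs.

Arguments Q {R} P t m u : rename.
Arguments V {R} P t m.
Arguments Qhat {R P S} sigma t p u : rename.
Arguments Vhat {R P S} sigma t p.
Arguments lip_Vhat {R P S} sigma t.

(* Main.v *)
Require Import Defs.
From HB Require Import structures.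
From mathcomp Require Import all_boot all_order all_algebra finmap.
From mathcomp Require Import all_classical all_reals all_analysis.
From mathcomp Require Import lra.

(** The accrued distribution is a disguised conditional maximum.  Write
[cond_max Y y f] for the maximum of [f] over the sample points compatible with
the realization [y] of [Y].  Then
  [r(x|y) = cond_max (X, Y) (x, y) A - cond_max Y y A],
and consequently, for every real function [g],
  [max_x (g x + r(x|y)) = cond_max Y y (g X + A) - cond_max Y y A],
a quantity called [excess A Y y (g X)] below.  Both dynamic programs are built
from such maxima, so each stage of either program is an excess over sample
points: the maximization variables [m_{t+1}] and [p_{t+1}] disappear, and the two
programs differ only in what is conditioned on and in the value function that
is evaluated along the trajectory.

A stage of the memory-based program is compared with the corresponding stage
of the approximate one in two moves.
- With the conditioning [(m_t, u_t)] kept, replacing [V_{t+1}] at the next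
  memory by [Vhat_{t+1}] at its compression costs at most [alpha_{t+1}], because
  an excess is monotone and commutes with adding a constant
  ([excess_dist_le]).
- With the function [c_t + Vhat_{t+1}] kept, replacing the conditioning
  [(m_t, u_t)] by [(sigma m_t, u_t)] costs at most [(K + 1) eps_t], where [K] is
  a Lipschitz constant of that function ([excess_dist_le_distr_dist]): a
  maximizing [x] has a nearest point [x'] in the other conditional range, at
  distance at most [eps_t] by the Hausdorff part of the distance, and the
  accrued distributions at [x] and [x'] differ by at most [eps_t] by its other
  part.  For the maximum metric on pairs one may take [K = 2 L_t].

At the horizon only the second move occurs, with [K] the Lipschitz constant of
[c_T].  There the approximate program conditions on [(p_T, u_T)] while the
hypothesis conditions on [p_T] alone; the two agree because the action [u_T] can
be changed freely without altering the state, the memory or the cost accrued up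
to time [T] ([excess_free_action]).  The same freedom shows that every pair of a
realizable memory and an action is realizable, so that all the maxima involved
are over nonempty sets and all values are finite.  Taking minima over actions
does not increase the error, and a backward induction on time concludes. *)

Set Implicit Arguments.
Unset Strict Implicit.
Unset Printing Implicit Defensive.

Import Order.TTheory GRing.Theory Num.Theory.

Local Open Scope fset_scope.
Local Open Scope ereal_scope.
Local Open Scope ring_scope.

(** * Finite minima of extended reals *)

Section ereal_facts.
Context {R : realType}.

(** No finiteness is needed: if either term is infinite, both differences
are. *)
Lemma abse_distC (x y : \bar R) : (`|x - y| = `|y - x|)%E.
Proof. by case: x y => [x| |] [y| |] //=; rewrite distrC. Qed.

Lemma bigmine_attained (I : finType) (i0 : I) (F : I -> \bar R) :
  exists2 i, \big[mine/+oo%E]_j F j = F i & forall j, (F i <= F j)%E.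
Proof.
have [i _ Fi] := @eq_bigmin _ _ _ (+oo%E : \bar R) i0 xpredT F isT
  (fun i _ => leey _).
by exists i => // j; rewrite -Fi; apply: bigmin_le.
Qed.

Lemma bigmine_fin_num (I : finType) (i0 : I) (F : I -> \bar R) :
  (forall i, F i \is a fin_num) -> \big[mine/+oo%E]_j F j \is a fin_num.
Proof. by have [i -> _] := bigmine_attained i0 F. Qed.

Lemma bigmine_dist_le (I : finType) (i0 : I) (F G : I -> \bar R) (a : R) :
  (forall i, F i \is a fin_num) -> (forall i, G i \is a fin_num) ->
  (forall i, (`|F i - G i| <= a%:E)%E) ->
  (`|\big[mine/+oo%E]_j F j - \big[mine/+oo%E]_j G j| <= a%:E)%E.
Proof.
move=> finF finG FG.
have [i -> mini] := bigmine_attained i0 F.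
have [j -> minj] := bigmine_attained i0 G.
move: (mini j) (minj i) (FG i) (FG j).
rewrite -(fineK (finF i)) -(fineK (finF j)) -(fineK (finG i)) -(fineK (finG j)).
by rewrite -!EFinB !abse_EFin !lee_fin !ler_norml; lra.
Qed.

End ereal_facts.

(** * Lipschitz constants of functions on finite sets *)

Section lipschitz.
Context {R : realType}.

Lemma lipschitz_const_ge0 (I : Type) (D : seq I) (d : I -> I -> R) g :
  0 <= lipschitz_const D d g.
Proof. exact: bigmax_ge_id. Qed.

(** Separation of [d] matters because the quotient at equal points is
[0 / 0 = 0], which bounds nothing: a vanishing distance must force equality. *)
Lemma lipschitz_constP (I : eqType) (D : seq I) (d : I -> I -> R) g x y :
    (forall p q, 0 <= d p q) -> (forall p q, d p q = 0 -> p = q) ->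
    x \in D -> y \in D ->
  `|g x - g y| <= lipschitz_const D d g * d x y.
Proof.
move=> d_ge0 d_eq0 xD yD.
have [/d_eq0->|dxy_neq0] := eqVneq (d x y) 0.
  by rewrite subrr normr0 mulr_ge0 ?lipschitz_const_ge0.
rewrite -ler_pdivrMr ?lt_def ?dxy_neq0 ?d_ge0//.
apply: (@bigmax_sup_seq _ _ _ _ _ (x)) => //.
exact: (le_bigmax_seq 0 y xpredT).
Qed.

End lipschitz.

(** * Conditional maxima and accrued distributions *)

Section conditional_maxima.
Context {R : realType} {Omega : finType}.

Lemma crangeP (E : choiceType) (F : eqType) (X : Omega -> E) (Y : Omega -> F) y x :
  reflect (exists2 w, Y w = y & x = X w) (x \in crange X Y y).
Proof.
apply: (iffP (imfsetP _ _ _ _)) => [[w]|[w Yw ->]].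
  by rewrite !inE /= => /eqP Yw ->; exists w.
by exists w => //; rewrite !inE /= Yw.
Qed.

Lemma urangeP (E : choiceType) (X : Omega -> E) x :
  reflect (exists w, x = X w) (x \in urange X).
Proof.
by apply: (iffP (imfsetP _ _ _ _)) => [[w _ ->]|[w ->]]; exists w.
Qed.

Definition cond_max (F : eqType) (Y : Omega -> F) (y : F) (f : Omega -> R) :
  \bar R := \big[maxe/-oo%E]_(w | Y w == y) (f w)%:E.

(** For realizable [y] the maximum is attained; case analysis on this
specification replaces an extended-real maximum by a real number [f w]. *)
Variant cond_max_spec (F : eqType) (Y : Omega -> F) y f : \bar R -> Prop :=
  CondMax w of Y w = y & (forall w', Y w' = y -> f w' <= f w) :
    cond_max_spec Y y f (f w)%:E.

Lemma cond_maxP (F : eqType) (Y : Omega -> F) w0 y f :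
  Y w0 = y -> cond_max_spec Y y f (cond_max Y y f).
Proof.
move=> /eqP Yw0.
have [w /eqP Yw fw] := @eq_bigmax _ _ _ (-oo%E : \bar R) w0 (fun w => Y w == y)
  (EFin \o f) Yw0 (fun w _ => leNye _).
rewrite /cond_max [X in cond_max_spec _ _ _ X]fw /=.
constructor=> // w' /eqP Yw'; rewrite -lee_fin.
by move: fw => /= <-; apply: (le_bigmax_cond _ (fun w => (f w)%:E) Yw').
Qed.

Lemma le_cond_max (F : eqType) (Y : Omega -> F) y f w :
  Y w = y -> ((f w)%:E <= cond_max Y y f)%E.
Proof. by move=> /eqP Yw; apply: (le_bigmax_cond _ (fun w => (f w)%:E) Yw). Qed.

Lemma cond_max_empty (F : eqType) (Y : Omega -> F) y f :
  (forall w, Y w <> y) -> cond_max Y y f = -oo%E.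
Proof. by move=> Yy; apply: big1_seq => w /andP[/eqP /Yy]. Qed.

Lemma eq_cond_max (F G : eqType) (Y : Omega -> F) (Z : Omega -> G) y z f g :
  (forall w, (Y w == y) = (Z w == z)) -> (forall w, Y w = y -> f w = g w) ->
  cond_max Y y f = cond_max Z z g.
Proof.
move=> YZ fg; apply: eq_big => // w /eqP Yw.
by rewrite fg.
Qed.

Section accrued.
Variables (A : Omega -> R) (Aset : {fset R}).
Hypothesis A_Aset : forall w, A w \in Aset.

(** The indicator is [-oo] exactly off the values that [A] takes on [Y = y], so
the finite set [Aset] leaves no trace as soon as it contains the values of
[A]. *)
Lemma max_indic (F : eqType) (Y : Omega -> F) y :
  (\big[maxe/-oo]_(a <- Aset) (a%:E + Defs.indic A a Y y))%E = cond_max Y y A.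
Proof.
apply/le_anti/andP; split.
  apply: bigmax_le => [|a _]; first exact: leNye.
  rewrite /Defs.indic.
  case: crangeP => [[w Yw ->]|_]; last by rewrite addeNy leNye.
  by rewrite adde0 le_cond_max.
apply: bigmax_le => [|w /eqP Yw]; first exact: leNye.
apply: (@bigmax_sup_seq _ _ _ _ _ (A w)) => //.
rewrite /Defs.indic; case: crangeP => [_|[]]; last by exists w.
by rewrite adde0.
Qed.

(** Conditioning [(X, A)] on [Y] at [(x, a)] is the same event as conditioning
[A] on [(X, Y)] at [a], so both maxima are instances of [max_indic]. *)
Lemma accrued_distrE (E : choiceType) (F : eqType) (X : Omega -> E) x
    (Y : Omega -> F) y :
  (accrued_distr A Aset X x Y y
   = cond_max (fun w => (X w, Y w)) (x, y) A - cond_max Y y A)%E.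
Proof.
rewrite /accrued_distr max_indic; congr (_ - _)%E.
rewrite -max_indic; apply: eq_bigr => a _; congr (_ + _)%E; rewrite /Defs.indic.
case: crangeP => [[w Yw [Xw Aw]]|nX]; case: crangeP => // nXY.
  by case: nXY; exists w; rewrite // Xw Yw.
by case: nXY => w [Xw Yw] Aw; case: nX; exists w; rewrite // Xw Aw.
Qed.

(** The worst total cost compatible with [y], normalized by the worst cost
accrued so far; it is the non-stochastic counterpart of the conditional
expectation of [g] given [Y = y]. *)
Definition excess (F : eqType) (Y : Omega -> F) y (g : Omega -> R) : \bar R :=
  (cond_max Y y (fun w => g w + A w)%R - cond_max Y y A)%E.

Lemma excess_fin_num (F : eqType) (Y : Omega -> F) w y g :
  Y w = y -> excess Y y g \is a fin_num.
Proof. by move=> Yw; rewrite /excess; do 2![case: (cond_maxP _ Yw) => ? _ _]. Qed.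

(** The tower property: maximizing over the values of [X] a function of that
value plus its accrued distribution amounts to maximizing over sample points at
once.  Values outside the conditional range contribute [-oo].  The injection [h]
is there since costs are functions on the finite type of states, whereas
distances are measured between their images in the ambient metric space. *)
Lemma max_accrued_distr (I E : choiceType) (F : eqType) (D : seq I)
    (X : Omega -> I) (h : I -> E) (Y : Omega -> F) w0 y (g : I -> R) :
    injective h -> Y w0 = y -> (forall w, Y w = y -> X w \in D) ->
  (\big[maxe/-oo]_(i <- D)
     ((g i)%:E + accrued_distr A Aset (fun w => h (X w)) (h i) Y y))%E
  = excess Y y (fun w => g (X w)).
Proof.
move=> h_inj Yw0 XD; rewrite /excess.
have [w1 Yw1 max1] := cond_maxP A Yw0.
apply/le_anti/andP; split.
  apply: bigmax_le => [|i _]; first exact: leNye.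
  rewrite accrued_distrE; case: (cond_maxP A Yw0) => w1' Yw1' max1'.
  have -> : A w1' = A w1 by apply/le_anti; rewrite max1 ?max1'.
  have [[w Yw Xw]|nXi] := pselect (exists2 w, Y w = y & X w = i); last first.
    rewrite cond_max_empty ?addeNy ?leNye// => w [/h_inj Xw Yw].
    by apply: nXi; exists w.
  have XYw : (h (X w), Y w) = (h i, y) by rewrite Xw Yw.
  case: (cond_maxP (Y := fun w => (h (X w), Y w)) A XYw) => w2 [/h_inj <- Yw2] _.
  rewrite addeA leeD2r// -EFinD.
  exact: (@le_cond_max _ Y y (fun w => g (X w) + A w)).
have [w2 Yw2 max2] := cond_maxP (fun w => g (X w) + A w) Yw0.
apply: (@bigmax_sup_seq _ _ _ _ _ (X w2)) => //; first exact: XD.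
rewrite accrued_distrE; case: (cond_maxP A Yw0) => w1' Yw1' max1'.
have -> : A w1' = A w1 by apply/le_anti; rewrite max1 ?max1'.
rewrite addeA leeD2r// EFinD leeD2l//.
by apply: (@le_cond_max _ (fun w => (h (X w), Y w))); rewrite Yw2.
Qed.


Lemma le_excess (F : eqType) (Y : Omega -> F) w0 y (g g' : Omega -> R) a :
  Y w0 = y -> (forall w, Y w = y -> g w <= g' w + a) ->
  (excess Y y g <= excess Y y g' + a%:E)%E.
Proof.
move=> Yw0 gg'; rewrite /excess.
case: (cond_maxP A Yw0) => w1 _ _.
case: (cond_maxP (fun w => g w + A w) Yw0) => w2 Yw2 _.
case: (cond_maxP (fun w => g' w + A w) Yw0) => w3 Yw3 /(_ w2 Yw2) le23.
by rewrite -!EFinB -EFinD lee_fin; move: (gg' w2 Yw2) le23; lra.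
Qed.

Lemma excess_dist_le (F : eqType) (Y : Omega -> F) w0 y (g g' : Omega -> R) a :
  Y w0 = y -> (forall w, Y w = y -> `|g w - g' w| <= a) ->
  (`|excess Y y g - excess Y y g'| <= a%:E)%E.
Proof.
move=> Yw0 gg'.
have : (excess Y y g <= excess Y y g' + a%:E)%E.
  by apply: le_excess Yw0 _ => w /gg'; rewrite ler_norml; lra.
have : (excess Y y g' <= excess Y y g + a%:E)%E.
  by apply: le_excess Yw0 _ => w /gg'; rewrite ler_norml; lra.
rewrite -(fineK (excess_fin_num g Yw0)) -(fineK (excess_fin_num g' Yw0)).
by rewrite -EFinB -!EFinD !lee_fin ler_norml; lra.
Qed.

Lemma eq_excess (F G : eqType) (Y : Omega -> F) (Z : Omega -> G) y z g g' :
  (forall w, (Y w == y) = (Z w == z)) -> (forall w, Y w = y -> g w = g' w) ->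
  excess Y y g = excess Z z g'.
Proof.
move=> YZ gg'; congr (_ - _)%E; apply: eq_cond_max => // w /gg'.
by move=> ->.
Qed.

Lemma distr_distC psi (E : metricType R) (F G : eqType) (X : Omega -> E)
    (Y : Omega -> F) y (Z : Omega -> G) z :
  distr_dist psi A Aset X Y y Z z = distr_dist psi A Aset X Z z Y y.
Proof.
rewrite /distr_dist; congr maxe.
  rewrite /hausdorff maxC; congr maxe.
    by do 2![apply: eq_bigr => ? _]; rewrite metric_sym.
  by do 2![apply: eq_bigr => ? _]; rewrite metric_sym.
by rewrite fsetUC; apply: eq_bigr => x _; rewrite abse_distC.
Qed.

(** The point [x'] is the nearest point to [x] in the other conditional range.
The distance compares the accrued distributions at the nearest points of [x] in
both ranges, but [x] is its own nearest point in the range that contains it. *)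
Lemma distr_dist_nearest psi (E : metricType R) (F G : eqType) (X : Omega -> E)
    (Y : Omega -> F) w0 (Z : Omega -> G) z e :
    nearest_selections psi ->
    (distr_dist psi A Aset X Y (Y w0) Z z <= e%:E)%E ->
    (exists w, Z w = z) ->
  exists2 w', Z w' = z & mdist (X w0) (X w') <= e /\
    (`|accrued_distr A Aset X (X w0) Y (Y w0)
       - accrued_distr A Aset X (X w') Z z| <= e%:E)%E.
Proof.
move=> psiP + [w1 Zw1]; rewrite ge_max => /andP[]; rewrite ge_max => /andP[hYZ _].
move=> rYZ; have xY : X w0 \in crange X Y (Y w0) by apply/crangeP; exists w0.
have [psiY minY] := psiP _ _ X Y w0 (X w0).
have psiYx : psi E F X Y (Y w0) (X w0) = X w0.
  apply/mdist_positivity/le_anti; rewrite mdist_ge0 andbT.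
  by apply: le_trans (minY _ xY) _; rewrite mdistxx.
have := psiP _ _ X Z w1 (X w0); rewrite Zw1 => -[/crangeP[w' Zw' psiZx] minZ].
exists w' => //; split.
  (* The distance to the nearest point is the inner minimum of the Hausdorff
     distance. *)
  rewrite -lee_fin; apply: le_trans (le_trans (le_bigmax_seq _ _ xpredT _ xY isT) hYZ).
  rewrite big_seq; apply: le_bigmin => [|y yZ]; first exact: leey.
  by rewrite lee_fin metric_sym -psiZx (metric_sym (X w0)) minZ.
apply: le_trans rYZ; apply: (@bigmax_sup_seq _ _ _ _ _ (X w0)) => //.
  by rewrite in_fsetU xY.
by rewrite psiYx psiZx.
Qed.

Section approximation.
Variables (psi : selection_family R Omega) (E : metricType R).
Variables (X : Omega -> E) (g : Omega -> R) (K : R).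
Hypotheses (psiP : nearest_selections psi) (K_ge0 : 0 <= K).
Hypothesis g_lip : forall w w', `|g w - g w'| <= K * mdist (X w) (X w').

(** Let [w] attain the left-hand maximum and [x = X w].  The nearest point [x']
loses at most [K e] through [g] and [e] through the accrued distribution, whose
value at [x'] is realized by some sample point with [Z = z] and [X = x']. *)
Lemma excess_le_distr_dist (F G : eqType) (Y : Omega -> F) (Z : Omega -> G) y z e :
    (exists w, Y w = y) -> (exists w, Z w = z) ->
    (distr_dist psi A Aset X Y y Z z <= e%:E)%E ->
  (excess Y y g <= excess Z z g + ((K + 1) * e)%:E)%E.
Proof.
move=> [w0 Yw0] [w1 Zw1] YZ; rewrite /excess.
have [w Yw maxw] := cond_maxP (fun w => g w + A w) Yw0.
move: YZ; rewrite -Yw => YZ.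
(* Below, [w2] and [w3] maximize the accrued cost among the sample points with
   the same [X] as [w] and [w'] respectively, and [w4] attains the right-hand
   maximum. *)
have [w' Zw' [XX]] := distr_dist_nearest psiP YZ (ex_intro _ w1 Zw1).
rewrite !accrued_distrE Yw.
case: (cond_maxP A Yw0) => wY _ _; case: (cond_maxP A Zw1) => wZ _ _.
have XYw : (X w, Y w) = (X w, y) by rewrite Yw.
have XZw : (X w', Z w') = (X w', z) by rewrite Zw'.
case: (cond_maxP (Y := fun w => (X w, Y w)) A XYw) => w2 _ /(_ w XYw) Aw.
case: (cond_maxP (Y := fun w => (X w, Z w)) A XZw) => w3 [Xw3 Zw3] _.
case: (cond_maxP (fun w => g w + A w) Zw1) => w4 _ /(_ w3 Zw3) le34.
rewrite -!EFinB abse_EFin -EFinD !lee_fin ler_norml => /andP[_ rr].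
have := g_lip w w3; rewrite Xw3 ler_norml => /andP[_ gg].
have := ler_wpM2l K_ge0 XX; lra.
Qed.

Lemma excess_dist_le_distr_dist (F G : eqType) (Y : Omega -> F) (Z : Omega -> G) y z e :
    (exists w, Y w = y) -> (exists w, Z w = z) ->
    (distr_dist psi A Aset X Y y Z z <= e%:E)%E ->
  (`|excess Y y g - excess Z z g| <= ((K + 1) * e)%:E)%E.
Proof.
move=> Yy Zz YZ.
have := excess_le_distr_dist Yy Zz YZ.
rewrite distr_distC in YZ; have := excess_le_distr_dist Zz Yy YZ.
case: Yy Zz => [w0 Yw0] [w1 Zw1].
rewrite -(fineK (excess_fin_num g Yw0)) -(fineK (excess_fin_num g Zw1)).
by rewrite -EFinB -!EFinD !lee_fin ler_norml; lra.
Qed.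

End approximation.
End accrued.
End conditional_maxima.

(** * Changing the current action *)

Section free_action.
Context {R : realType} (P : system R).
Local Notation T := (horizon P).

Definition set_action t (u : Uset P) (w : sample P) : sample P :=
  (w.1, [ffun i => if i == inord t then u else w.2 i]).

Lemma action_set_action t u w : action t (set_action t u w) = u.
Proof. by rewrite /action ffunE eqxx. Qed.

Lemma action_set_action_lt t u w s : (s < t <= T)%N ->
  action s (set_action t u w) = action s w.
Proof.
move=> /andP[st tT]; rewrite /action ffunE; case: eqP => // /(congr1 val) /=.
rewrite !inordK ?ltnS//; last exact: leq_trans (ltnW st) tT.
by move=> est; rewrite est ltnn in st.
Qed.

Lemma state_set_action t u w s : (s <= t <= T)%N ->
  state s (set_action t u w) = state s w.
Proof.
elim: s => [//|s IHs] /andP[st tT] /=.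
by rewrite IHs ?(ltnW st)// action_set_action_lt ?st.
Qed.

Lemma mem_var_set_action t u w : (t <= T)%N ->
  mem_var t (set_action t u w) = mem_var t w.
Proof.
move=> tT; congr pair; apply: eq_mktuple => i.
  by rewrite /observation state_set_action// -ltnS ltn_ord.
by rewrite action_set_action_lt// ltn_ord.
Qed.

Lemma accrued_set_action t u w : (t <= T)%N ->
  accrued t (set_action t u w) = accrued t w.
Proof.
move=> tT; apply: eq_bigr => i _.
by rewrite state_set_action ?action_set_action_lt// ?(ltnW (ltn_ord i)) ?ltn_ord.
Qed.

(** An action that influences neither the conditioning nor the function can be
fixed in advance without changing the maximum. *)
Lemma cond_max_free_action (F : eqType) (Y : sample P -> F) t u y
    (f : sample P -> R) :
    (forall w, Y (set_action t u w) = Y w) ->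
    (forall w, f (set_action t u w) = f w) ->
  cond_max (fun w => (Y w, action t w)) (y, u) f = cond_max Y y f.
Proof.
move=> Yt ft; have [[w0 Yw0]|nY] := pselect (exists w, Y w = y); last first.
  rewrite !cond_max_empty// => [w Yw|w [Yw _]]; by apply: nY; exists w.
have Ytw0 : (Y (set_action t u w0), action t (set_action t u w0)) = (y, u).
  by rewrite Yt action_set_action Yw0.
case: (cond_maxP f Yw0) => w1 Yw1 max1.
case: (cond_maxP (Y := fun w => (Y w, action t w)) f Ytw0) => w2 [Yw2 _] max2.
congr EFin; apply/le_anti; rewrite max1//= -(ft w1) max2//.
by rewrite Yt action_set_action Yw1.
Qed.

Lemma excess_free_action (A : sample P -> R) (F : eqType) (Y : sample P -> F) t u y
    (f : sample P -> R) :
    (forall w, A (set_action t u w) = A w) ->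
    (forall w, Y (set_action t u w) = Y w) ->
    (forall w, f (set_action t u w) = f w) ->
  excess A (fun w => (Y w, action t w)) (y, u) f = excess A Y y f.
Proof.
move=> At Yt ft; congr (_ - _)%E; apply: cond_max_free_action => // w.
by rewrite At ft.
Qed.

End free_action.

(** * The dynamic programs as excesses *)

Section programs.
Context {R : realType} (P : model R).
Local Notation T := (horizon P).

Lemma Uset_inhabited : Uset P.
Proof. by have /fset0Pn/cid[u uU] := Uset_neq0 P; exists u. Qed.

(** One stage of either program: [Z] is the next memory in the memory-based
program and the next information state in the approximate one. *)
Lemma max_cost_info t (E : choiceType) (Z : sample P -> E) (s : {fset E})
    (v : E -> R) (F : eqType) (Y : sample P -> F) w0 y u :
    (t <= T)%N -> Y w0 = y -> (forall w, Z w \in s) ->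
  (\big[maxe/-oo]_(x : Xset P) \big[maxe/-oo]_(e <- s)
     ((cost t x u + v e)%:E
      + rdistr t (fun w => (statev t w, Z w)) (val x, e) Y y))%E
  = excess (accrued t) Y y (fun w => cost t (state t w) u + v (Z w)).
Proof.
move=> tT Yw0 Zs; pose X w := (state t w, Z w).
pose h (p : Xset P * E) : Defs.space P * E := (val p.1, p.2).
have h_inj : injective h by move=> [x e] [x' e'] [/val_inj -> ->].
have XD w : Y w = y -> X w \in [seq (x, e) | x <- index_enum (Xset P), e <- s].
  by move=> _; apply/allpairsP; exists (X w); rewrite mem_index_enum Zs.
rewrite -(max_accrued_distr (fun w => accrued_Aset w tT)
  (fun p => cost t p.1 u + v p.2) h_inj Yw0 XD).
by rewrite big_allpairs.
Qed.

Lemma Q_last_excess w0 m u : mem_var T w0 = m ->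
  Q P T m u = excess (accrued T) (mem_var T) m (fun w => cost T (state T w) u).
Proof.
move=> mw0; rewrite Q_lastE.
rewrite -(max_accrued_distr (D := index_enum _)
  (fun w => accrued_Aset w (leqnn T)) (fun x => cost T x u) val_inj mw0) // => w _.
exact: mem_index_enum.
Qed.

(** The current action is not constrained by the memory, which only records
the earlier ones. *)
Lemma mem_action_realized t m u : (t <= T)%N -> m \in memories P t ->
  exists w, mem_action t w = (m, u).
Proof.
move=> tT /urangeP[w ->]; exists (set_action t u w).
by rewrite /mem_action mem_var_set_action// action_set_action.
Qed.

Lemma Q_step_excess t m u : (t < T)%N -> m \in memories P t ->
    (forall m', m' \in memories P t.+1 -> V P t.+1 m' \is a fin_num) ->
  Q P t m u = excess (accrued t) (@mem_action _ P t) (m, u)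
    (fun w => cost t (state t w) u + fine (V P t.+1 (mem_var t.+1 w))).
Proof.
move=> tT mP Vfin; have [w0 mw0] := mem_action_realized u (ltnW tT) mP.
rewrite Q_stepE// -(@max_cost_info t _ (mem_var t.+1) (memories P t.+1)
  (fun m' => fine (V P t.+1 m')) _ _ w0)// ?(ltnW tT)//; last first.
  by move=> w; apply/urangeP; exists w.
apply: eq_bigr => x _; apply: eq_big_seq => m' /Vfin Vm'.
by rewrite EFinD fineK.
Qed.

(** Realizability of [m] is essential: conditioning on an impossible memory
gives infinite values. *)
Lemma Q_fin_num t m u : (t <= T)%N -> m \in memories P t ->
  Q P t m u \is a fin_num.
Proof.
move=> /subnKC; move: (T - t)%N => k; elim: k t m u => [|k IHk] t m u.
  rewrite addn0 => eT; subst t => /urangeP[w mw].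
  by rewrite (Q_last_excess u (esym mw)) (excess_fin_num _ _ (esym mw)).
rewrite addnS => eT mP; have tT : (t < T)%N by rewrite -eT ltnS leq_addr.
rewrite Q_step_excess//; last first.
  move=> m' mP'; apply: (bigmine_fin_num Uset_inhabited) => u'.
  by apply: IHk; rewrite ?addSn.
have [w mw] := mem_action_realized u (ltnW tT) mP.
exact: (excess_fin_num _ _ mw).
Qed.

Lemma V_fin_num t m : (t <= T)%N -> m \in memories P t -> V P t m \is a fin_num.
Proof.
by move=> tT mP; apply: (bigmine_fin_num Uset_inhabited) => u; apply: Q_fin_num.
Qed.

Section approximate.
Variables (S : nat -> metricType R) (sigma : forall t, memory P t -> S t).

Lemma info_action_realized t m u : (t <= T)%N -> m \in memories P t ->
  exists w, info_action sigma t w = (sigma m, u).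
Proof.
move=> tT /(mem_action_realized u tT)[w [mw uw]]; exists w.
by rewrite /info_action /info_var mw uw.
Qed.

Lemma info_var_in t w : info_var sigma t w \in info_set sigma t.
Proof. by apply/urangeP; exists w. Qed.

(** The last stage conditions on [(p, u)], but the action at the horizon affects
none of the variables involved, so conditioning on [p] gives the same value. *)
Lemma Qhat_last_excess m u : m \in memories P T ->
  Qhat sigma T (sigma m) u
  = excess (accrued T) (info_var sigma T) (sigma m) (fun w => cost T (state T w) u).
Proof.
move=> mP; have [w0 mw0] := info_action_realized u (leqnn T) mP.
rewrite Qhat_lastE -(@excess_free_action _ P (accrued T) _ _ T u).
- rewrite -(max_accrued_distr (D := index_enum _)
    (fun w => accrued_Aset w (leqnn T)) (fun x => cost T x u) val_inj mw0) // => w _.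
  exact: mem_index_enum.
- by move=> w; apply: accrued_set_action.
- by move=> w; rewrite /info_var mem_var_set_action.
- by move=> w; rewrite state_set_action ?leqnn.
Qed.

Lemma Qhat_step_excess t m u : (t < T)%N -> m \in memories P t ->
    (forall p, p \in info_set sigma t.+1 -> Vhat sigma t.+1 p \is a fin_num) ->
  Qhat sigma t (sigma m) u = excess (accrued t) (info_action sigma t) (sigma m, u)
    (fun w => cost t (state t w) u + fine (Vhat sigma t.+1 (info_var sigma t.+1 w))).
Proof.
move=> tT mP Vfin; have [w0 mw0] := info_action_realized u (ltnW tT) mP.
rewrite Qhat_stepE// -(@max_cost_info t _ (info_var sigma t.+1) (info_set sigma t.+1)
  (fun p => fine (Vhat sigma t.+1 p)) _ _ w0)// ?(ltnW tT)//; last first.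
  exact: info_var_in.
apply: eq_bigr => x _; apply: eq_big_seq => p /Vfin Vp.
by rewrite EFinD fineK// [X in (X + _)%E]addeC.
Qed.

Lemma Qhat_fin_num t m u : (t <= T)%N -> m \in memories P t ->
  Qhat sigma t (sigma m) u \is a fin_num.
Proof.
move=> /subnKC; move: (T - t)%N => k; elim: k t m u => [|k IHk] t m u.
  rewrite addn0 => eT; subst t => mP; rewrite Qhat_last_excess//.
  have [w [mw _]] := info_action_realized u (leqnn T) mP.
  exact: (excess_fin_num _ _ mw).
rewrite addnS => eT mP; have tT : (t < T)%N by rewrite -eT ltnS leq_addr.
rewrite Qhat_step_excess//; last first.
  move=> p /urangeP[w ->]; apply: (bigmine_fin_num Uset_inhabited) => u'.
  by apply: IHk; rewrite ?addSn//; apply/urangeP; exists w.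
have [w mw] := info_action_realized u (ltnW tT) mP.
exact: (excess_fin_num _ _ mw).
Qed.

Lemma Vhat_fin_num t p : (t <= T)%N -> p \in info_set sigma t ->
  Vhat sigma t p \is a fin_num.
Proof.
move=> tT /urangeP[w ->]; apply: (bigmine_fin_num Uset_inhabited) => u.
by apply: Qhat_fin_num => //; apply/urangeP; exists w.
Qed.

Lemma cost_lipschitz t (x x' : Xset P) u :
  `|cost t x u - cost t x' u| <= lip_cost P t * mdist (val x) (val x').
Proof.
have := @lipschitz_constP _ _ (enum {: Xset P * Uset P})
  (fun p q => mdist (val p.1, val p.2) (val q.1, val q.2))
  (fun p => cost t p.1 p.2) (x, u) (x', u).
rewrite !mem_enum /= mdist_prodE /= mdistxx.
rewrite [Num.max _ 0]max_l ?mdist_ge0//; apply => // [p q|p q].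
  exact: mdist_ge0.
by case: p q => [p1 p2] [q1 q2] /mdist_positivity[/val_inj-> /val_inj->].
Qed.

Lemma Vhat_lipschitz t w w' :
  `|fine (Vhat sigma t (info_var sigma t w)) - fine (Vhat sigma t (info_var sigma t w'))|
  <= lip_Vhat sigma t * mdist (info_var sigma t w) (info_var sigma t w').
Proof.
apply: (@lipschitz_constP _ _ _ _ (fun p => fine (Vhat sigma t p))).
- exact: mdist_ge0.
- exact: mdist_positivity.
- exact: info_var_in.
- exact: info_var_in.
Qed.

(** The factor 2 accounts for the two summands: each varies by at most [L] times
the larger of the two coordinate distances. *)
Lemma cost_to_go_lipschitz t u (w w' : sample P) :
  let g (w : sample P) := cost t (state t w) u + fine (Vhat sigma t.+1 (info_var sigma t.+1 w)) in
  `|g w - g w'| <= 2 * Num.max (lip_Vhat sigma t.+1) (lip_cost P t)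
                   * mdist (state_info sigma t w) (state_info sigma t w').
Proof.
rewrite /= mdist_prodE /=; set L := Num.max (lip_Vhat _ _) _.
set D := Num.max (mdist _ _) _.
have lec : lip_cost P t * mdist (statev t w) (statev t w') <= L * D.
  by apply: ler_pM; rewrite ?lipschitz_const_ge0 ?mdist_ge0 ?le_max ?lexx ?orbT.
have leV : lip_Vhat sigma t.+1 * mdist (info_var sigma t.+1 w) (info_var sigma t.+1 w')
    <= L * D.
  by apply: ler_pM; rewrite ?lipschitz_const_ge0 ?mdist_ge0 ?le_max ?lexx ?orbT.
have := cost_lipschitz t (state t w) (state t w') u.
have := Vhat_lipschitz t.+1 w w'; rewrite !ler_norml.
by move: lec leV; rewrite /statev; lra.
Qed.

(** * Error bounds *)

Section error_bounds.
Variables (psi : selection_family R (sample P)) (eps : nat -> R).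
Hypotheses (psiP : nearest_selections psi) (aisP : approx_info_state sigma psi eps).

Lemma Q_last_dist m u : m \in memories P T ->
  (`|Q P T m u - Qhat sigma T (sigma m) u| <= ((lip_cost P T + 1) * eps T)%:E)%E.
Proof.
move=> mP; case/urangeP: (mP) => w0 mw0.
rewrite (Q_last_excess u (esym mw0)) Qhat_last_excess//.
apply: (excess_dist_le_distr_dist (fun w => accrued_Aset w (leqnn T)) psiP
  (X := @statev _ P T)).
- exact: lipschitz_const_ge0.
- by move=> w w'; apply: cost_lipschitz.
- by exists w0.
- by exists w0; rewrite /info_var mw0.
- exact: ais_last aisP _ mP.
Qed.

Lemma Q_step_dist t m u a : (t < T)%N -> m \in memories P t ->
    (forall m', m' \in memories P t.+1 ->
       (`|V P t.+1 m' - Vhat sigma t.+1 (sigma m')| <= a%:E)%E) ->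
  (`|Q P t m u - Qhat sigma t (sigma m) u|
   <= (a + (2 * Num.max (lip_Vhat sigma t.+1) (lip_cost P t) + 1) * eps t)%:E)%E.
Proof.
move=> tT mP VV.
have [w0 mw0] := mem_action_realized u (ltnW tT) mP.
have Vfin w : V P t.+1 (mem_var t.+1 w) \is a fin_num.
  by apply: V_fin_num => //; apply/urangeP; exists w.
have Vhatfin w : Vhat sigma t.+1 (info_var sigma t.+1 w) \is a fin_num.
  by apply: Vhat_fin_num => //; apply: info_var_in.
rewrite Q_step_excess//; last by move=> m'; apply: V_fin_num.
rewrite Qhat_step_excess//; last by move=> p; apply: Vhat_fin_num.
set g := fun w => cost t (state t w) u + fine (V _ _ _).
set ghat := fun w => cost t (state t w) u + fine (Vhat _ _ _).
have gg : (`|excess (accrued t) (@mem_action _ P t) (m, u) g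
    - excess (accrued t) (@mem_action _ P t) (m, u) ghat| <= a%:E)%E.
  apply: excess_dist_le mw0 _ => w _.
  rewrite /g /ghat opprD addrACA subrr add0r -lee_fin -abse_EFin EFinB !fineK//.
  by apply: VV; apply/urangeP; exists w.
have : (`|excess (accrued t) (@mem_action _ P t) (m, u) ghat
    - excess (accrued t) (info_action sigma t) (sigma m, u) ghat|
    <= ((2 * Num.max (lip_Vhat sigma t.+1) (lip_cost P t) + 1) * eps t)%:E)%E.
  apply: (excess_dist_le_distr_dist (fun w => accrued_Aset w (ltnW tT)) psiP
    (X := state_info sigma t)).
  - by rewrite mulr_ge0// le_max lipschitz_const_ge0.
  - by move=> w w'; apply: cost_to_go_lipschitz.
  - by exists w0.
  - exact: info_action_realized (ltnW tT) mP.
  - exact: ais_step aisP _ _ _ _ mP.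
have [w1 mw1] := info_action_realized u (ltnW tT) mP.
move: gg; rewrite -(fineK (excess_fin_num _ g mw0)) -(fineK (excess_fin_num _ ghat mw0)).
rewrite -(fineK (excess_fin_num _ ghat mw1)).
by rewrite -!EFinB !abse_EFin !lee_fin !ler_norml; lra.
Qed.

Lemma V_dist t m a : (t <= T)%N -> m \in memories P t ->
    (forall u, (`|Q P t m u - Qhat sigma t (sigma m) u| <= a%:E)%E) ->
  (`|V P t m - Vhat sigma t (sigma m)| <= a%:E)%E.
Proof.
move=> tT mP QQ; apply: (bigmine_dist_le Uset_inhabited) => // u.
  exact: Q_fin_num.
exact: Qhat_fin_num.
Qed.

End error_bounds.
End approximate.
End programs.

Theorem theorem3 (R : realType) (P : model R)
    (psi : selection_family R (sample P))
    (S : nat -> metricType R)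
    (sigma : forall t : nat, memory P t -> S t)
    (eps alpha : nat -> R) :
  nearest_selections psi ->
  approx_info_state sigma psi eps ->
  alpha (horizon P) = (lip_cost P (horizon P) + 1) * eps (horizon P) ->
  (forall t : nat, (t < horizon P)%N ->
     alpha t = alpha t.+1
       + (2 * Num.max (lip_Vhat sigma t.+1) (lip_cost P t) + 1) * eps t) ->
  forall t : nat, (t <= horizon P)%N ->
  forall m : memory P t, m \in memories P t ->
    (forall u : Uset P,
       (`| Q P t m u - Qhat sigma t (sigma t m) u | <= (alpha t)%:E)%E) /\
    (`| V P t m - Vhat sigma t (sigma t m) | <= (alpha t)%:E)%E.
Proof.
move=> psiP aisP alphaT alphaS t tT m mP.
suff QQ u : (`| Q P t m u - Qhat sigma t (sigma t m) u | <= (alpha t)%:E)%E.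
  by split=> //; apply: V_dist.
move: tT => /subnKC; move: (horizon P - t)%N => k.
elim: k t m mP u => [|k IHk] t m mP u.
  by rewrite addn0 => eT; subst t; rewrite alphaT; apply: (Q_last_dist psiP aisP).
rewrite addnS => eT; have tT : (t < horizon P)%N by rewrite -eT ltnS leq_addr.
rewrite alphaS//; apply: (Q_step_dist psiP aisP) => // m' mP'.
by apply: V_dist => // u'; apply: IHk; rewrite ?addSn.
Qed.
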